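(* Let $M$ be a loopless matroid of rank $r$ on a finite ground set $E$, let $\mathcal G$ be a building set of $M$ containing $E$, and let $d=r-1$. Assume $d\ge 2$. Then $$d\int_{M,\mathcal G}c_1(T_{M,\mathcal G})^2\alpha^{d-2}\ \le\ 2(d+1)\int_{M,\mathcal G}c_2(T_{M,\mathcal G})\,\alpha^{d-2}.$$
   Context: $M$ is a loopless matroid on a finite nonempty set $E$ with rank function $\operatorname{rk}$, $r=\operatorname{rk}(E)$, lattice of flats $\mathcal L(M)$ (minimum $\emptyset$, maximum $E$, join $\vee$). A subset $\mathcal G\subseteq\mathcal L(M)\setminus\{\emptyset\}$ is a building set if for every nonempty flat $F$, with $G_1,\dots,G_s$ the maximal elements of $\mathcal G$ contained in $F$, the join map $[\emptyset,G_1]\times\cdots\times[\emptyset,G_s]\to[\emptyset,F]$ is a poset isomorphism. A subset $\mathcal S\subseteq\mathcal G\setminus\{E\}$ is $\mathcal G$-nested if every collection of $m\ge2$ pairwise incomparable elements of $\mathcal S$ has join not in $\mathcal G$. In $N_E=\mathbb Z^E/\mathbb Z(1,\dots,1)$ let $v_F$ be the image of $\sum_{i\in F}e_i$; the nested-set fan $\Sigma_{M,\mathcal G}$ consists of the cones $\operatorname{cone}(v_F:F\in\mathcal S)$, $\mathcal S$ $\mathcal G$-nested, and $X_{M,\mathcal G}$ is its smooth toric variety. $\mathsf A(M,\mathcal G)$ is the Chow ring of $X_{M,\mathcal G}$, presented as $\mathbb Z[x_F:F\in\mathcal G\setminus\{E\}]$ modulo monomials $x_{F_1}\cdots x_{F_m}$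 for non-nested $\{F_1,\dots,F_m\}$ and the linear forms $\sum_{F\ni i}x_F-\sum_{F\ni j}x_F$ ($i,j\in E$, sums over $F\in\mathcal G\setminus\{E\}$). Put $\alpha=\sum_{F\in\mathcal G\setminus\{E\},\,i\in F}x_F$ (independent of $i\in E$). $\int_{M,\mathcal G}:\mathsf A^{d}(M,\mathcal G)\to\mathbb Z$ is the degree isomorphism, normalized by $\int\alpha^d=1$. $\mathsf K(M,\mathcal G)=K_0(X_{M,\mathcal G})$; $\mathcal O(D)$ is the line bundle of $D\in\mathsf A^1(M,\mathcal G)$. For $F\in\mathcal G\setminus\{E\}$ put $\theta_F^{\mathcal G}=\alpha-\sum_{H\in\mathcal G,\,F\subseteq H\subsetneq E}x_H$. The tangent class is $$T_{M,\mathcal G}:=r[\mathcal O(\alpha)]-[\mathcal O]+\sum_{F\in\mathcal G\setminus\{E\}}\Big([\mathcal O(x_F)]-[\mathcal O]+\operatorname{rk}(F)\big([\mathcal O(\theta_F^{\mathcal G})]-[\mathcal O(\theta_F^{\mathcal G}+x_F)]\big)\Big)\in\mathsf K(M,\mathcal G),$$ so its total Chern class is $c(T_{M,\mathcal G})=(1+\alpha)^r\prod_{F\in\mathcal G\setminus\{E\}}(1+x_F)\left(\frac{1+\theta_F^{\mathcal G}}{1+\theta_F^{\mathcal G}+x_F}\right)^{\operatorname{rk}(F)}$, and $c_k$ denotes its degree-$k$ part. *)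

(* Defs.v *)
From HB Require Import structures.
From mathcomp Require Import all_boot all_order all_algebra.
From mathcomp Require Import generic_quotient ring_quotient.
From mathcomp Require Import boolp.
From mathcomp Require Import freeg mpoly.
From mathcomp Require Import ring.

Set Implicit Arguments.
Unset Strict Implicit.
Unset Printing Implicit Defensive.

Import GRing.Theory.

Local Open Scope ring_scope.
Local Open Scope quotient_scope.

Record matroid (E : finType) := Matroid {
  rk :> {set E} -> nat;
  rk_le_card : forall A, (rk A <= #|A|)%N;
  rk_mono : forall A B : {set E}, A \subset B -> (rk A <= rk B)%N;
  rk_submod : forall A B, (rk (A :|: B) + rk (A :&: B) <= rk A + rk B)%N
}.

Section Combinatorics.
Variables (E : finType) (M : matroid E).
Implicit Types (F H K : {set E}) (G S C : {set {set E}}).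

Definition loopless : Prop := forall i : E, M [set i] = 1%N.

Definition cl (A : {set E}) : {set E} := [set i | M (i |: A) == M A].

Definition flat F : bool := cl F == F.

Definition flats_below F : {set {set E}} := [set H | flat H & H \subset F].

Definition join C : {set E} := cl (cover C).

Definition factors G F : {set {set E}} :=
  [set H | maxset [pred K | (K \in G) && (K \subset F)] H].

(* The product of the intervals [set0, H] of the lattice of flats, for H a    *)
(* factor of F: pfamily makes its members total functions, equal to set0      *)
(* outside the factors.                                                       *)
Definition factor_product G F :=
  pfamily (set0 : {set E}) (mem (factors G F)) (fun H => mem (flats_below H)).

Definition join_map G F (f : {ffun {set E} -> {set E}}) : {set E} :=
  cl (\bigcup_(H in factors G F) f H).

(* An isomorphism of posets is a surjection that preserves and reflects <=.   *)
Definition join_map_iso G F : Prop :=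
  [/\ forall f, f \in factor_product G F -> join_map G F f \in flats_below F,
      forall f g, f \in factor_product G F -> g \in factor_product G F ->
        (join_map G F f \subset join_map G F g)
          = [forall H in factors G F, f H \subset g H]
    & forall K, K \in flats_below F ->
        exists2 f, f \in factor_product G F & join_map G F f = K].

Definition building_set G : Prop :=
  (forall F, F \in G -> flat F /\ F != set0)
  /\ (forall F, flat F -> F != set0 -> join_map_iso G F).

Definition antichain C : bool :=
  [forall F in C, forall H in C, (F \subset H) ==> (F == H)].

Definition nested G S : bool :=
  (S \subset G :\ [set: E])
  && [forall C : {set {set E}},
        [&& C \subset S, (1 < #|C|)%N & antichain C] ==> (join C \notin G)].

Lemma nested0 G : nested G set0.
Proof.
rewrite /nested sub0set; apply/forallP => C; apply/implyP => /and3P[].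
by rewrite subset0 => /eqP->; rewrite cards0.
Qed.

End Combinatorics.

Inductive generated (R : pzRingType) (gen : R -> Prop) : R -> Prop :=
| Generated0 : generated gen 0
| GeneratedD a u v of gen u & generated gen v : generated gen (a * u + v).

Section ClassicalUnits.
Variable R : comNzRingType.

(* Invertibility in a quotient by an arbitrary ideal is not decidable, so the *)
(* unitRingType structure is obtained classically.                            *)
Definition cunit (x : R) : bool := `[< exists y, y * x = 1 >].

Definition cinv (x : R) : R :=
  if pselect (exists y, y * x = 1) is left ex then projT1 (cid ex) else x.

Lemma cinvP : {in cunit, left_inverse 1 cinv *%R}.
Proof.
move=> x /asboolP ex; rewrite /cinv; case: pselect => // ex'.
by case: cid.
Qed.

Lemma cunitP x y : y * x = 1 -> cunit x.
Proof. by move=> yx; apply/asboolP; exists y. Qed.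

Lemma cinv_out : {in [predC cunit], cinv =1 id}.
Proof. by move=> x /asboolP nex; rewrite /cinv; case: pselect. Qed.

End ClassicalUnits.

Section ChowRing.
Variables (E : finType) (M : matroid E) (G : {set {set E}}).

Definition ray := {F : {set E} | F \in G :\ [set: E]}.
HB.instance Definition _ := Finite.on ray.
HB.instance Definition _ := SubType.on ray.

Local Notation poly := {mpoly int[#|{: ray}|]}.

Definition var (F : ray) : poly := 'X_(enum_rank F).

Inductive chow_relation : poly -> Prop :=
| ChowMonomial (S : {set ray}) of ~~ nested M G [set val F | F in S] :
    chow_relation (\prod_(F in S) var F)
| ChowLinear (i j : E) :
    chow_relation (\sum_(F : ray | i \in val F) var F
                   - \sum_(F : ray | j \in val F) var F).

Definition chow_ideal : pred poly := [pred p | `[< generated chow_relation p >]].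

Lemma chow_relation0 p : chow_relation p -> p@_0 = 0.
Proof.
have v0 (F : ray) : (var F)@_0 = 0 by rewrite mcoeffX mnm1_eq0.
case=> [S|i j].
  case: (set_0Vmem S) => [->|[F FS] _]; first by rewrite imset0 nested0.
  by rewrite (bigD1 F) //= [LHS](rmorphM (mcoeff 0%MM)) /= v0 mul0r.
by rewrite mcoeffB !raddf_sum /= !big1 ?subr0 // => F _; rewrite v0 ?oppr0.
Qed.

Lemma chow_ideal_closed : idealr_closed chow_ideal.
Proof.
split.
- by apply/asboolP; exact: Generated0.
- have gen0 (p : poly) : generated chow_relation p -> p@_0 = 0.
    elim=> [|a u v /chow_relation0 u0 _ v0]; first by rewrite mcoeff0.
    by rewrite mcoeffD [(a * u)@_0](rmorphM (mcoeff 0%MM)) /= u0 v0 mulr0 addr0.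
  by apply/negP => /asboolP /gen0 /eqP; rewrite mcoeff1 eqxx.
- move=> a u v /asboolP gu /asboolP gv; apply/asboolP.
  elim: gu => [|b w t rw _ IH]; first by rewrite mulr0 add0r.
  by rewrite mulrDr mulrA -addrA; exact: GeneratedD.
Qed.

HB.instance Definition _ := isIdealr.Build poly chow_ideal chow_ideal_closed.

Definition chow := {ideal_quot (chow_ideal : idealr poly)}.

HB.instance Definition _ := GRing.ComNzRing.on chow.
HB.instance Definition _ := Quotient.on chow.
HB.instance Definition _ :=
  GRing.ComNzRing_hasMulInverse.Build chow
    (@cinvP chow) (@cunitP chow) (@cinv_out chow).

Definition chow_homog (k : nat) : pred chow :=
  [pred D | `[< exists2 p : poly, p \is k.-homog & D = \pi_chow p >]].

Lemma chow_homog_closed k : zmod_closed (chow_homog k).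
Proof.
split; first by apply/asboolP; exists 0; rewrite ?rpred0 ?raddf0.
move=> _ _ /asboolP[p hp ->] /asboolP[q hq ->]; apply/asboolP.
by exists (p - q); rewrite ?rpredB ?raddfB.
Qed.

HB.instance Definition _ k :=
  GRing.isZmodClosed.Build chow (chow_homog k) (chow_homog_closed k).

(* This does not depend on the representative: see homog_part_pi.             *)
Definition homog_part (k : nat) (a : chow) : chow :=
  \pi_chow (pihomog mdeg k (repr a)).

(* The elements of A^1, i.e. the divisor classes of the toric variety.        *)
Record divisor := Divisor {
  chow_of_divisor :> chow;
  divisorP : chow_of_divisor \in chow_homog 1
}.

HB.instance Definition _ := [isSub for chow_of_divisor].
HB.instance Definition _ := [Choice of divisor by <:].
HB.instance Definition _ := [SubChoice_isSubZmodule of divisor by <:].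

Lemma var_divisor (F : ray) : \pi_chow (var F) \in chow_homog 1.
Proof. by apply/asboolP; exists (var F); rewrite // dhomogX /=; apply/eqP/mdeg1. Qed.

Definition x_ (F : ray) : divisor := Divisor (var_divisor F).

(* The sum does not depend on the element i picked: see alphaE.               *)
Definition alpha : divisor :=
  if [pick i : E] is Some i then \sum_(F : ray | i \in val F) x_ F else 0.

Definition theta (F : ray) : divisor :=
  alpha - \sum_(H : ray | val F \subset val H) x_ H.

End ChowRing.

Arguments chow {E} M G.
Arguments divisor {E} M G.
Arguments x_ {E M G} F.
Arguments alpha {E M G}.
Arguments theta {E M G} F.

(* K_0 of a smooth toric variety X, as an abelian group: it is generated by   *)
(* the classes of the line bundles O(D), D in Pic X = A^1, subject to the     *)
(* relations given by the Koszul complexes of the sections cutting out the    *)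
(* boundary divisors D_F, F in S, twisted by O(D), when these divisors have   *)
(* empty intersection, i.e. when S does not span a cone of the fan:           *)
(*   sum_(T subset S) (-1)^#|T| [O(D - sum_(F in T) D_F)] = 0.                *)
Section KTheory.
Variables (E : finType) (M : matroid E) (G : {set {set E}}).
Local Notation ray := (ray G).
Local Notation chow := (chow M G).
Local Notation divisor := (divisor M G).

Definition koszul (D : divisor) (S : {set ray}) : {freeg divisor} :=
  \sum_(T : {set ray} | T \subset S) << (-1) ^+ #|T| *g D - \sum_(F in T) x_ F >>.

Inductive koszul_relation : {freeg divisor} -> Prop :=
| KoszulRelation (D : divisor) (S : {set ray})
    of ~~ nested M G [set val F | F in S] : koszul_relation (koszul D S).

Inductive zspan (V : zmodType) (gen : V -> Prop) : V -> Prop :=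
| Span0 : zspan gen 0
| SpanB u v of gen u & zspan gen v : zspan gen (v - u)
| SpanD u v of gen u & zspan gen v : zspan gen (v + u).

Definition K_relations : pred {freeg divisor} := [pred V | `[< zspan koszul_relation V >]].

Lemma K_relations_closed : zmod_closed K_relations.
Proof.
split; first by apply/asboolP; exact: Span0.
move=> V W /asboolP gV /asboolP gW; apply/asboolP.
elim: gW => [|R W' rR _ IH|R W' rR _ IH]; first by rewrite subr0.
- by rewrite opprB addrCA addrC; exact: SpanD.
- by rewrite opprD addrA; exact: SpanB.
Qed.

HB.instance Definition _ :=
  GRing.isZmodClosed.Build {freeg divisor} K_relations K_relations_closed.

Definition K0 := {ideal_quot GRing.ZmodClosed.clone _ K_relations _}.

HB.instance Definition _ := GRing.Zmodule.on K0.
HB.instance Definition _ := Quotient.on K0.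

Definition line_bundle (D : divisor) : K0 := \pi_K0 << D >>.

Definition chern_virtual (V : {freeg divisor}) : chow :=
  \prod_(D <- dom V) (1 + chow_of_divisor D) ^ coeff D V.

(* The total Chern class does not depend on the representative, because 1 + D *)
(* is invertible for D in A^1: see divisor_unit, chern_pi and chernD.         *)
Definition chern (xi : K0) : chow := chern_virtual (repr xi).

Definition chern_class (k : nat) (xi : K0) : chow := homog_part k (chern xi).

Local Notation O := line_bundle.

Definition tangent_class : K0 :=
  O alpha *+ M [set: E] - O 0
  + \sum_(F : ray) (O (x_ F) - O 0
                    + (O (theta F) - O (theta F + x_ F)) *+ M (val F)).

(* deg restricts to an isomorphism of groups A^d -> Z that maps alpha^d to 1; *)
(* its values outside A^d are irrelevant.                                     *)
Definition degree_iso (deg : chow -> int) : Prop :=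
  let d := (M [set: E]).-1 in let A := @chow_homog E M G d in
  [/\ {in A &, {morph deg : a b / a + b}},
      {in A &, injective deg},
      forall n, exists2 a, a \in A & deg a = n
    & deg ((alpha : chow) ^+ d) = 1].
End KTheory.

Section ClosureTheory.
Variables (E : finType) (M : matroid E).
Implicit Types (A B F H K P : {set E}) (G S C : {set {set E}}).

Lemma sub_closure A : A \subset cl M A.
Proof. by apply/subsetP => i iA; rewrite inE (setUidPr _) ?sub1set. Qed.

Lemma rk_setU1_mono A B i : A \subset B -> M (i |: A) = M A -> M (i |: B) = M B.
Proof.
move=> AB iA; apply/eqP; rewrite eqn_leq [X in _ && X]rk_mono ?subsetUr // andbT.
have := rk_submod M (i |: A) B; rewrite iA -setUA (setUidPr AB) => le.
have leA : (M A <= M ((i |: A) :&: B))%N.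
  by apply: rk_mono; rewrite subsetI subsetUr.
by rewrite -(leq_add2l (M A)) (leq_trans _ le) // addnC leq_add2l.
Qed.

Lemma closure_mono A B : A \subset B -> cl M A \subset cl M B.
Proof.
move=> AB; apply/subsetP => i; rewrite !inE => /eqP iA.
by apply/eqP/(rk_setU1_mono AB).
Qed.

Lemma rk_closure A : M (cl M A) = M A.
Proof.
suff rkU (s : seq E) : {subset s <= cl M A} -> M ([set i in s] :|: A) = M A.
  rewrite -[in RHS](rkU (enum (cl M A))) => [|i]; last by rewrite mem_enum.
  by congr (M _); rewrite set_enum; apply/esym/setUidPl/sub_closure.
elim: s => [|i s IH] sub; first by congr (M _); apply/setP => i; rewrite !inE.
rewrite set_cons -setUA -[in RHS]IH; last first.
  by move=> j js; apply: sub; rewrite inE js orbT.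
apply: (rk_setU1_mono (A := A)); rewrite ?subsetUr //.
by have := sub i (mem_head _ _); rewrite inE => /eqP.
Qed.

Lemma flat_closure A : flat M (cl M A).
Proof.
rewrite /flat eqEsubset sub_closure andbT; apply/subsetP => i.
rewrite !inE rk_closure => /eqP iA; rewrite eqn_leq [X in _ && X]rk_mono ?subsetUr // andbT.
by rewrite -[leqRHS]iA; apply/rk_mono/setUS/sub_closure.
Qed.

Lemma closure_sub_flat A F : flat M F -> A \subset F -> cl M A \subset F.
Proof. by move=> /eqP {2}<-; exact: closure_mono. Qed.

Hypothesis Mll : loopless M.

Lemma rk0 : M set0 = 0%N.
Proof. by apply/eqP; rewrite -leqn0 -(cards0 E) rk_le_card. Qed.

Lemma closure0 : cl M set0 = set0.
Proof. by apply/setP => i; rewrite !inE setU0 Mll rk0. Qed.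

Variable G : {set {set E}}.
Hypothesis Gb : building_set M G.

Lemma factor_exists K F : F \in G -> F \subset K ->
  exists2 A, A \in factors G K & F \subset A.
Proof.
move=> FG FK.
have [|A mA FA] := @maxset_exists _ [pred H | (H \in G) && (H \subset K)] F.
  by rewrite /= FG.
by exists A; rewrite // inE.
Qed.

Lemma factorP K A : A \in factors G K -> A \in G /\ A \subset K.
Proof. by rewrite inE => /maxsetp /andP. Qed.

Lemma building_join F H i : F \in G -> H \in G -> i \in F -> i \in H ->
  cl M (F :|: H) \in G.
Proof.
move=> FG HG iF iH; set K := cl M (F :|: H).
have [Gf Giso] := Gb.
have Kf : flat M K by exact: flat_closure.
have FHK : F :|: H \subset K by exact: sub_closure.
have FK : F \subset K by apply: subset_trans FHK; exact: subsetUl.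
have HK : H \subset K by apply: subset_trans FHK; exact: subsetUr.
have K0 : K != set0 by apply/set0Pn; exists i; rewrite (subsetP FK).
have [A Af FA] := factor_exists FG FK.
have [B Bf HB] := factor_exists HG HK.
have [AG AK] := factorP Af.
have [BG BK] := factorP Bf.
have [AB|nAB] := eqVneq A B.
  suff -> : K = A by [].
  apply/eqP; rewrite eqEsubset AK andbT.
  by apply: closure_sub_flat; [case: (Gf A AG) | rewrite subUset FA AB].
exfalso; have [_ emb _] := Giso K Kf K0.
pose c := cl M [set i].
pose f (C : {set E}) : {ffun {set E} -> {set E}} := [ffun D => if D == C then c else set0].
have ff (C : {set E}) : C \in factors G K -> i \in C -> f C \in factor_product M G K.
  move=> Cf iC; apply/pfamilyP; split.
    apply/subsetP => D; rewrite inE ffunE.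
    by have [->|_] := eqVneq D C; rewrite ?eqxx.
  move=> D Df; rewrite ffunE; have [->|_] := eqVneq D C; last first.
    by rewrite !inE /flat closure0 sub0set eqxx.
  rewrite !inE flat_closure closure_sub_flat ?sub1set //.
  by case: (factorP Cf) => /Gf[].
have jf (C : {set E}) : C \in factors G K -> join_map M G K (f C) = cl M c.
  move=> Cf; congr cl; rewrite (bigD1 C) //= ffunE eqxx big1 ?setU0 //.
  by move=> D /andP[_ /negPf nD]; rewrite ffunE nD.
have iA := subsetP FA _ iF; have iB := subsetP HB _ iH.
have := emb _ _ (ff A Af iA) (ff B Bf iB); rewrite !jf // subxx.
move=> /esym/forallP/(_ A); rewrite Af /= !ffunE eqxx (negPf nAB).
by move=> /subsetP/(_ i (subsetP (sub_closure _) _ (set11 i))); rewrite in_set0.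
Qed.

Variable S : {set {set E}}.
Hypothesis nS : nested M G S.

Lemma nestedW F : F \in S -> F \in G /\ F != [set: E].
Proof.
by move: nS => /andP[/subsetP sub _] /sub; rewrite !inE => /andP[].
Qed.

Lemma nested_antichain C : C \subset S -> (1 < #|C|)%N -> antichain C ->
  join M C \notin G.
Proof.
by move: nS => /andP[_ /forallP/(_ C)/implyP h] *; apply: h; apply/and3P.
Qed.

Lemma nested_comparable F H i : F \in S -> H \in S -> i \in F -> i \in H ->
  (F \subset H) || (H \subset F).
Proof.
move=> FS HS iF iH; apply: contraT; rewrite negb_or => /andP[FH HF].
have [FG _] := nestedW FS; have [HG _] := nestedW HS.
have nFH : F != H by apply: contraNneq FH => ->.
have := @nested_antichain [set F; H]; rewrite cards2 nFH subUset !sub1set FS HS.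
rewrite /join /cover bigcup_setU !big_set1 (building_join FG HG iF iH).
move=> h; suff: false by []; apply: h => //.
apply/forallP => X; apply/implyP => /set2P[]->; apply/forallP => Y;
  apply/implyP => /set2P[]->; rewrite ?eqxx ?implybT //.
- by rewrite (negPf FH).
- by rewrite (negPf HF).
Qed.

Lemma nested_private P : P \in G ->
  exists2 i, i \in P & forall H, H \in S -> H \proper P -> i \notin H.
Proof.
move=> PG; have [Pf P0] := (proj1 Gb) P PG.
pose B := [set H in S | H \proper P].
suff /subsetPn[i iP iB] : ~~ (P \subset cover B).
  exists i => // H HS HP; apply: contra iB => iH.
  by apply/bigcupP; exists H; rewrite // inE HS.
apply/negP => PB.
pose C := [set H | maxset (mem B) H].
have CB H : H \in C -> H \in B by rewrite inE => /maxsetp.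
have covC : cover C = P.
  apply/eqP; rewrite eqEsubset; apply/andP; split.
    apply/bigcupsP => H /CB; rewrite inE => /andP[_]; exact: proper_sub.
  apply: (subset_trans PB); apply/bigcupsP => H HB.
  have [K mK HK] := @maxset_exists _ (mem B) H HB.
  by apply: (subset_trans HK); apply: bigcup_sup; rewrite inE.
have := @nested_antichain C.
rewrite /join covC (eqP Pf) PG => h; suff: false by []; apply: h.
- by apply/subsetP => H /CB; rewrite inE => /andP[].
- rewrite ltnNge; apply/negP => le1.
  have [C0|[H HC]] := set_0Vmem C.
    by move: P0; rewrite -covC C0 /cover big_set0 eqxx.
  move: (CB H HC); rewrite inE => /andP[_ /andP[_]]; rewrite -covC.
  suff -> : C = [set H] by rewrite /cover big_set1 subxx.
  by apply/eqP; rewrite eq_sym eqEcard sub1set HC cards1.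
- apply/forallP => H; apply/implyP => HC; apply/forallP => K.
  apply/implyP => KC; apply/implyP => HK.
  move: HC; rewrite inE => /maxsetP[_ /(_ K) h]; apply/eqP/esym; apply: h => //.
  exact: CB.
Qed.

Hypothesis GE : [set: E] \in G.

Lemma nested_unimodular F : F \in S ->
  exists i j, j \notin F /\ forall H, H \in S -> (i \in H) = (H == F) || (j \in H).
Proof.
move=> FS; have [FG FT] := nestedW FS.
pose above (P : {set E}) := (P \in [set: E] |: S) && (F \proper P).
have aboveT : above [set: E] by rewrite /above setU11 properT.
case: (arg_minnP (fun P : {set E} => #|P|) aboveT) => P /andP[PS FP] Pmin.
have PG : P \in G by case/setU1P: PS => [->//|/nestedW[]].
have [i iF iN] := nested_private FG.
have [j jP jN] := nested_private PG.
have iE H : H \in S -> (i \in H) = (F \subset H).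
  move=> HS; apply/idP/idP => [iH|/subsetP]; last exact.
  apply: contraT => nFH; have HF : H \subset F.
    by have := nested_comparable FS HS iF iH; rewrite (negPf nFH).
  by move: (iN H HS); rewrite properE HF nFH iH => /(_ isT).
have jE H : H \in S -> (j \in H) = (P \subset H).
  move=> HS; apply/idP/idP => [jH|/subsetP]; last exact.
  apply: contraT => nPH; have HP : H \subset P.
    case/setU1P: PS => [->|PS']; first exact: subsetT.
    by have := nested_comparable PS' HS jP jH; rewrite (negPf nPH).
  by move: (jN H HS); rewrite properE HP nPH jH => /(_ isT).
exists i, j; split; first by apply: jN; rewrite // FP.
move=> H HS; rewrite iE // jE //; have [->|nHF] /= := eqVneq H F.
  by rewrite subxx.
apply/idP/idP => [FH|PH]; last by apply: subset_trans PH; exact: proper_sub.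
have FpH : F \proper H by rewrite properEneq eq_sym nHF FH.
have le : (#|P| <= #|H|)%N by apply: Pmin; rewrite /above !inE HS orbT FpH.
case/setU1P: PS => [PT|PS].
  suff -> : H = [set: E] by rewrite subsetT.
  by apply/eqP; rewrite eqEcard subsetT -PT.
have iP : i \in P by apply: (subsetP (proper_sub FP)).
have iH : i \in H by apply: (subsetP FH).
have [//|HP] := orP (nested_comparable PS HS iP iH).
have /eqP -> : H == P by rewrite eqEcard HP le.
by rewrite subxx.
Qed.
End ClosureTheory.

Section ChowTheory.
Variables (E : finType) (M : matroid E) (G : {set {set E}}).
Local Notation ray := (ray G).
Local Notation chow := (chow M G).
Local Notation poly := {mpoly int[#|{: ray}|]}.
Local Notation pi := (\pi_chow : poly -> chow).

Lemma pi_eq0 (p : poly) : generated (@chow_relation E M G) p -> \pi_chow p = 0.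
Proof.
move=> gp; rewrite -(raddf0 pi); apply/eqP.
by rewrite -Quotient.idealrBE subr0; apply/asboolP.
Qed.

Lemma generated1 (p : poly) : chow_relation M p -> generated (@chow_relation E M G) p.
Proof. by move=> rp; rewrite -[p]mul1r -[_ * _]addr0; exact/GeneratedD/Generated0. Qed.

Lemma chow_monomial (S : {set ray}) : ~~ nested M G [set val F | F in S] ->
  \prod_(F in S) (x_ F : chow) = 0.
Proof.
by move=> nS; rewrite /= -rmorph_prod; apply/pi_eq0/generated1/ChowMonomial.
Qed.

Lemma chow_linear (i j : E) :
  \sum_(F : ray | i \in val F) (x_ F : chow) = \sum_(F : ray | j \in val F) (x_ F : chow).
Proof.
apply/eqP; rewrite -subr_eq0 /= -!rmorph_sum -rmorphB; apply/eqP.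
by apply/pi_eq0/generated1/ChowLinear.
Qed.

Lemma divisor_sum (I : finType) (P : pred I) (f : I -> divisor M G) :
  chow_of_divisor (\sum_(i | P i) f i) = \sum_(i | P i) chow_of_divisor (f i).
Proof. exact: (raddf_sum val). Qed.

Lemma alphaE (i : E) : alpha = \sum_(F : ray | i \in val F) x_ F :> divisor M G.
Proof.
apply: val_inj; rewrite /alpha; case: pickP => [j _|/(_ i)//].
by rewrite /= !divisor_sum; exact: chow_linear.
Qed.

Lemma pihomogM (n k e : nat) (a u : {mpoly int[n]}) : u \is e.-homog ->
  pihomog mdeg k (a * u) = if (e <= k)%N then pihomog mdeg (k - e) a * u else 0.
Proof.
move=> hu; have hj j : pihomog mdeg j a * u \is (j + e).-homog.
  by apply: dhomogM => //; exact: pihomogP.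
rewrite {1}(pihomog_partitionE (leqnn (mmeasure mdeg a))) mulr_suml raddf_sum /=.
have E1 (j : nat) : pihomog mdeg k (pihomog mdeg j a * u) =
    if (j + e == k)%N then pihomog mdeg j a * u else 0.
  case: eqP => [<-|/eqP ne]; first exact: pihomog_dE.
  by apply: pihomog_ne0 (hj j); first exact: ne.
under eq_bigr do rewrite E1.
case: leqP => [ek|ke]; last first.
  by rewrite big1 // => j _; case: eqP => // jk; move: ke; rewrite -jk ltnNge leq_addl.
have [lt|ge] := ltnP (k - e) (mmeasure mdeg a).
  rewrite (bigD1 (Ordinal lt)) //= subnK // eqxx big1 ?addr0 // => j /eqP nj.
  by case: eqP => // jk; case: nj; apply: val_inj; rewrite /= -jk addnK.
rewrite big1 => [|j _]; last first.
  by case: eqP => // jk; move: (ltn_ord j); rewrite ltnNge -(addnK e j) jk ge.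
rewrite pihomogE big_seq_cond big1 ?mul0r // => m /andP[ms /eqP md].
have := mmeasure_mnm_lt mdeg ms; rewrite md ltnNge ge => /negP; by case.
Qed.

Lemma var_homog (F : ray) : var F \is 1.-homog.
Proof. by rewrite dhomogX /=; apply/eqP/mdeg1. Qed.

Lemma chow_relation_homog (p : poly) : chow_relation M p -> exists e, p \is e.-homog.
Proof.
case=> [S _|i j].
  exists #|S|; rewrite -sum1_card; elim/big_rec2: _ => [|F k q _ hq].
    exact: dhomog1.
  by apply: dhomogM hq; exact: var_homog.
by exists 1%N; apply: rpredB; apply: rpred_sum => F _; exact: var_homog.
Qed.

Lemma pihomog_ideal k (p : poly) : p \in @chow_ideal E M G ->
  pihomog mdeg k p \in @chow_ideal E M G.
Proof.
move=> /asboolP; elim=> [|a u v ru _ IH]; first by rewrite raddf0 rpred0.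
rewrite raddfD rpredD //= (pihomogM _ _ (proj2_sig (cid (chow_relation_homog ru)))).
by case: ifP => _; rewrite ?rpred0 //; apply/idealMr/asboolP/generated1.
Qed.

Lemma homog_part_pi k (p : poly) : homog_part k (\pi_chow p) = \pi_chow (pihomog mdeg k p).
Proof.
apply/eqP; rewrite -Quotient.idealrBE -raddfB; apply: pihomog_ideal.
by rewrite Quotient.idealrBE reprK.
Qed.

Definition nilpotent_elt (R : comNzRingType) (a : R) := exists n, a ^+ n = 0.

Lemma nilpotentM (R : comNzRingType) (a b : R) : nilpotent_elt b -> nilpotent_elt (a * b).
Proof. by case=> n bn; exists n; rewrite exprMn bn mulr0. Qed.

Lemma nilpotentD (R : comNzRingType) (a b : R) :
  nilpotent_elt a -> nilpotent_elt b -> nilpotent_elt (a + b).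
Proof.
move=> [n an] [m bm]; exists (n + m)%N; rewrite exprDn big1 // => i _.
have [mi|im] := leqP m i; first by rewrite -(subnK mi) [b ^+ _]exprD bm !mulr0 mul0rn.
suff -> : a ^+ (n + m - i) = 0 by rewrite mul0r mul0rn.
by rewrite -addnBA ?(ltnW im) // exprD an mul0r.
Qed.

Lemma nilpotent_unit (R : comUnitRingType) (a : R) : nilpotent_elt a -> 1 + a \is a GRing.unit.
Proof.
move=> [n an]; apply/unitrPr; exists (\sum_(i < n) (- a) ^+ i).
have := subrX1 (- a) n; rewrite exprNn an mulr0 sub0r => h.
by apply: oppr_inj; rewrite -mulNr opprD [- 1 - a]addrC -h.
Qed.

Hypothesis (Mll : loopless M) (Gb : building_set M G) (GE : [set: E] \in G).

Lemma nested_annihilate (S : {set ray}) (F : ray) (Z : chow) :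
    nested M G [set val H | H in S] -> F \in S ->
    (forall H, H \notin S -> Z * (x_ H : chow) = 0) ->
  Z * (x_ F : chow) = 0.
Proof.
move=> nS FS Z0.
have [i [j [jF ij]]] := nested_unimodular Mll Gb nS GE (imset_f val FS).
have rel : \sum_(H : ray) (Z * (x_ H : chow)) *+ (i \in val H)
         = \sum_(H : ray) (Z * (x_ H : chow)) *+ (j \in val H).
  under eq_bigr do rewrite mulrb; under [RHS]eq_bigr do rewrite mulrb.
  by rewrite -!big_mkcond -!big_distrr /= (chow_linear i j).
move/eqP: rel; rewrite -subr_eq0 -sumrB (bigD1 F) //= big1 ?addr0.
  by rewrite (negPf jF) subr0 ij ?imset_f // eqxx => /eqP.
move=> H HF; have [HS|/Z0->] := boolP (H \in S); last by rewrite !mul0rn subrr.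
by rewrite ij ?imset_f // (inj_eq val_inj) (negPf HF) subrr.
Qed.

Lemma x_nilpotent_aux n (S : {set ray}) F : F \in S -> (#|~: S| <= n)%N ->
  (\prod_(H in S) (x_ H : chow)) * (x_ F : chow) ^+ n.+1 = 0.
Proof.
elim: n S => [|n IH] S FS le; have [nS|/chow_monomial->] :=
  boolP (nested M G [set val F | F in S]); rewrite ?mul0r //;
  rewrite exprSr mulrA; apply: (nested_annihilate nS FS) => H HS.
- suff : (0 < #|~: S|)%N by rewrite ltnNge le.
  by apply/card_gt0P; exists H; rewrite inE.
- rewrite mulrAC [X in X * _]mulrC -big_setU1 //=.
  apply: IH; first by rewrite !inE FS orbT.
  rewrite -ltnS; apply: leq_trans le; apply: proper_card.
  rewrite properC properEneq subsetUr andbT; apply: contraNneq HS => ->.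
  by rewrite setU11.
Qed.

Lemma x_nilpotent F : nilpotent_elt (x_ F : chow).
Proof.
exists (#|~: [set F]|.+2); rewrite exprS.
by have := x_nilpotent_aux (set11 F) (leqnn _); rewrite big_set1.
Qed.

Lemma divisor_nilpotent (D : divisor M G) : nilpotent_elt (D : chow).
Proof.
case: D => _ /= /asboolP[p hp ->]; rewrite (mpolyE p) raddf_sum /=.
have nil0 : nilpotent_elt (0 : chow) by exists 1%N.
rewrite big_seq; elim/big_rec: _ => [//|m a ms na].
apply: nilpotentD => //; rewrite -mul_mpolyC rmorphM /=; apply: nilpotentM.
have /mdeg1P[k /eqP->] : mdeg m == 1%N by rewrite (dhomog_mf hp ms).
have -> : 'X_k = var (enum_val k) by rewrite /var enum_valK.
exact: x_nilpotent.
Qed.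

Lemma divisor_unit (D : divisor M G) : 1 + (D : chow) \is a GRing.unit.
Proof. exact/nilpotent_unit/divisor_nilpotent. Qed.

End ChowTheory.

Section KoszulProduct.
Variables (R : comNzRingType) (I : finType) (y : I -> R).
Implicit Types S T : {set I}.

Definition kprod (b : bool) S : {poly R} :=
  \prod_(T : {set I} | (T \subset S) && (odd #|T| == b)) ('X - (\sum_(i in T) y i)%:P).

Lemma kprod0 b : kprod b set0 = if b then 1 else 'X.
Proof.
rewrite /kprod; case: b.
  by rewrite big1 // => T /andP[]; rewrite subset0 => /eqP->; rewrite cards0.
rewrite (big_pred1 set0) ?big_set0 ?subr0 // => T; rewrite subset0.
by have [->|/negPf nT] := eqVneq T set0; rewrite /= ?cards0 ?eqxx // [RHS]nT.
Qed.

Lemma kprodU b i S : i \notin S ->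
  kprod b (i |: S) = kprod b S * (kprod (~~ b) S \Po ('X - (y i)%:P)).
Proof.
move=> iS; rewrite /kprod (bigID (fun T : {set I} => i \in T)) /= mulrC; congr (_ * _).
  apply: eq_bigl => T; rewrite andbAC; congr (_ && _).
  apply/andP/idP => [[/subsetP sub iT]|TS].
    apply/subsetP => j jT; have := sub j jT; rewrite !inE => /orP[/eqP ji|//].
    by rewrite -ji jT in iT.
  split; first by apply: subset_trans TS _; exact: subsetUr.
  by apply: contra iS; exact: (subsetP TS).
rewrite rmorph_prod /=.
rewrite (reindex_onto (fun T => i |: T) (fun T => T :\ i)) /=; last first.
  by move=> T /andP[_ iT]; rewrite setD1K.
apply: eq_big => [T|T /andP[/andP[/andP[_ _] _] /eqP Ti]].
  rewrite setU11 andbT; have [iT|iT] := boolP (i \in T).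
    rewrite (_ : (_ == T) = false) ?andbF.
      by apply/esym/negbTE; apply: contra iS => /andP[/subsetP/(_ _ iT)].
    by apply/negbTE; apply: contraTneq iT => <-; rewrite !inE eqxx.
  rewrite setU1K // eqxx andbT cardsU1 iT /= setUC; congr (_ && _).
    apply/subsetP/subsetP => sub j jT.
      have := sub j; rewrite !inE jT => /(_ isT) /orP[/eqP ji|//].
      by rewrite -ji jT in iT.
    by move: jT; rewrite !inE => /orP[/sub->|->]; rewrite ?orbT.
  by case: (odd _); case: (b).
have iT : i \notin T by rewrite -Ti !inE eqxx.
by rewrite big_setU1 //= linearB /= comp_polyX comp_polyC polyCD opprD addrA.
Qed.

Lemma comp_poly_shift (P : {poly R}) a : exists Q, P \Po ('X - a%:P) = P - a%:P * Q.
Proof.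
elim/poly_ind: P => [|P c [Q IH]]; first by exists 0; rewrite comp_poly0 mulr0 subr0.
exists (P + Q * ('X - a%:P)).
rewrite comp_polyD comp_polyM comp_polyX comp_polyC IH; ring.
Qed.

Lemma kprod_dvd S : S != set0 ->
  exists q, kprod false S = kprod true S + (\prod_(i in S) y i)%:P * q.
Proof.
have [n le] := ubnP #|S|; elim: n S le => // n IH S le /set0Pn[i iS].
have iT : i \notin S :\ i by rewrite !inE eqxx.
rewrite -(setD1K iS); set T := S :\ i; rewrite !kprodU //= big_setU1 //=.
have [->|T0] := eqVneq T set0.
  exists 1; by rewrite !kprod0 big_set0 comp_polyX -[1 \Po _]/(comp_poly _ 1) rmorph1 !mulr1 mul1r subrK.
have [|q eq] := IH T _ T0.
  by rewrite -ltnS; apply: leq_trans le; rewrite ltnS (cardsD1 i S) iS.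
rewrite eq; set O := kprod true T; set p := _%:P.
have [O1 eqO] := comp_poly_shift O (y i); have [q1 eq1] := comp_poly_shift q (y i).
exists (O * q1 - q * O1).
rewrite comp_polyD comp_polyM comp_polyC eq1 !eqO.
rewrite /p !polyCM; ring.
Qed.
End KoszulProduct.

Section ChernTheory.
Variables (E : finType) (M : matroid E) (G : {set {set E}}).
Hypothesis (Mll : loopless M) (Gb : building_set M G) (GE : [set: E] \in G).
Local Notation ray := (ray G).
Local Notation chow := (chow M G).
Local Notation divisor := (divisor M G).

Let uD (D : divisor) := divisor_unit Mll Gb GE D.

Lemma chern_virtualE (s : seq divisor) (V : {freeg divisor}) :
  uniq s -> {subset dom V <= s} ->
  chern_virtual V = \prod_(D <- s) (1 + chow_of_divisor D) ^ coeff D V.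
Proof.
move=> us sub; rewrite /chern_virtual [RHS](bigID (fun D => D \in dom V)) /= [X in _ * X]big1_seq.
  rewrite mulr1 -[RHS]big_filter; apply: perm_big; apply: uniq_perm.
  - exact: uniq_dom.
  - exact: filter_uniq.
  by move=> D; rewrite mem_filter; case: (boolP (D \in dom V)) => // /sub ->.
by move=> D /andP[/coeff_outdom->].
Qed.

Lemma chern_virtualD (V W : {freeg divisor}) : chern_virtual (V + W) = chern_virtual V * chern_virtual W.
Proof.
pose s := undup (dom V ++ dom W).
have sV : {subset dom V <= s} by move=> D DV; rewrite mem_undup mem_cat DV.
have sW : {subset dom W <= s} by move=> D DV; rewrite mem_undup mem_cat DV orbT.
have sVW : {subset dom (V + W) <= s} by move=> D /domD_subset; rewrite mem_undup.
have us : uniq s by exact: undup_uniq.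
rewrite (chern_virtualE us sV) (chern_virtualE us sW) (chern_virtualE us sVW) -big_split /=.
by apply: eq_bigr => D _; rewrite coeffD exprzDr // uD.
Qed.

Lemma chern_virtual0 : chern_virtual (0 : {freeg divisor}) = 1.
Proof. by rewrite /chern_virtual dom0 big_nil. Qed.

Lemma chern_virtualU (k : int) (D : divisor) : chern_virtual << k *g D >> = (1 + (D : chow)) ^ k.
Proof.
have [->|k0] := eqVneq k 0; first by rewrite freegU0 chern_virtual0 expr0z.
by rewrite /chern_virtual domU // big_seq1 coeffU eqxx mulr1.
Qed.

Lemma chern_virtual_koszul (D : divisor) (S : {set ray}) :
  ~~ nested M G [set val F | F in S] -> chern_virtual (koszul D S) = 1.
Proof.
move=> nS; have S0 : S != set0.
  by apply: contraNneq nS => ->; rewrite imset0 nested0.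
have morph (P : pred {set ray}) (f : {set ray} -> {freeg divisor}) :
    chern_virtual (\sum_(T | P T) f T) = \prod_(T | P T) chern_virtual (f T).
  exact: (big_morph _ chern_virtualD chern_virtual0).
have [q eq] := kprod_dvd (fun F => x_ F : chow) S0.
have valE (T : {set ray}) : 1 + chow_of_divisor (D - \sum_(F in T) x_ F) =
   (1 + (D : chow)) - \sum_(F in T) (x_ F : chow).
  by rewrite /= divisor_sum addrA.
have kE b : (kprod (fun F => x_ F : chow) b S).[1 + (D : chow)] =
    \prod_(T : {set ray} | (T \subset S) && (odd #|T| == b))
      (1 + chow_of_divisor (D - \sum_(F in T) x_ F)).
  by rewrite horner_prod; apply: eq_bigr => T _; rewrite valE !hornerE.
move/(congr1 (horner^~ (1 + (D : chow)))): eq.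
rewrite hornerD hornerM hornerC chow_monomial // mul0r addr0 !kE => eq.
rewrite /koszul morph (bigID (fun T : {set ray} => odd #|T| == false)) /=.
under eq_bigr => T /andP[_ /eqP oT] do rewrite chern_virtualU -signr_odd oT expr1z.
rewrite eq -[RHS](mulrV (x := \prod_(T : {set ray} | (T \subset S) && (odd #|T| == true)) (1 + chow_of_divisor (D - \sum_(F in T) x_ F)))); last first.
  by apply: rpred_prod => T _; exact: uD.
congr (_ * _).
rewrite -prodrV; last by move=> T _; exact: uD.
apply: eq_big => [T|T /andP[_ oT]]; first by case: odd.
by rewrite chern_virtualU -signr_odd; move: oT; case: odd => //; rewrite expr1.
Qed.

Lemma chern_virtual_ideal (V : {freeg divisor}) : V \in @K_relations E M G -> chern_virtual V = 1.
Proof.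
have koszul1 (u : {freeg divisor}) : koszul_relation u -> chern_virtual u = 1.
  by case=> D S nS; exact: chern_virtual_koszul.
move=> /asboolP; elim=> [|u v /koszul1 cu _ cv|u v /koszul1 cu _ cv].
- exact: chern_virtual0.
- by rewrite -[LHS]mulr1 -[X in _ * X = _]cu -chern_virtualD subrK.
- by rewrite chern_virtualD cu cv mulr1.
Qed.

Lemma chern_pi (V : {freeg divisor}) : chern (\pi_(K0 M G) V) = chern_virtual V.
Proof.
rewrite /chern -[X in chern_virtual X](subrK V) chern_virtualD chern_virtual_ideal ?mul1r //.
by rewrite Quotient.idealrBE reprK.
Qed.

Lemma chernD (xi eta : K0 M G) : chern (xi + eta) = chern xi * chern eta.
Proof. by rewrite -[xi]reprK -[eta]reprK -raddfD !chern_pi chern_virtualD. Qed.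

Lemma chern_line_bundle (D : divisor) : chern (line_bundle D) = 1 + (D : chow).
Proof. by rewrite chern_pi chern_virtualU expr1z. Qed.

Lemma chernK0 : chern (0 : K0 M G) = 1.
Proof. by rewrite -(raddf0 (\pi_(K0 M G))) chern_pi chern_virtual0. Qed.

Lemma chern_unit (xi : K0 M G) : chern xi \is a GRing.unit.
Proof. by apply/unitrPr; exists (chern (- xi)); rewrite -chernD subrr chernK0. Qed.

Lemma chernN (xi : K0 M G) : chern (- xi) = (chern xi)^-1.
Proof.
apply: (mulrI (chern_unit xi)).
by rewrite -chernD subrr chernK0 mulrV ?chern_unit.
Qed.

Lemma chernMn (xi : K0 M G) n : chern (xi *+ n) = chern xi ^+ n.
Proof.
elim: n => [|n IH]; first by rewrite mulr0n chernK0.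
by rewrite mulrSr chernD IH exprSr.
Qed.

Lemma chern_tangent :
  chern (tangent_class M G) =
    (1 + (alpha : chow)) ^+ M [set: E] *
    \prod_(F : ray)
       ((1 + (x_ F : chow)) *
        ((1 + (theta F : chow)) / (1 + (theta F : chow) + (x_ F : chow)))
          ^+ M (val F)).
Proof.
have O1 : chern (line_bundle (0 : divisor)) = 1 by rewrite chern_line_bundle addr0.
rewrite /tangent_class !(chernD, chernN) O1 invr1 mulr1 chernMn chern_line_bundle.
congr (_ * _); rewrite (big_morph _ chernD chernK0); apply: eq_bigr => F _.
rewrite !(chernD, chernN, chernMn) O1 invr1 mulr1 !chern_line_bundle.
by congr (_ * (_ / _) ^+ _); exact: addrA.
Qed.

End ChernTheory.

(* Main.v *)
(* Write N for the number of flats of rank 2 in G. The monomial of a set S of *)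
(* rays times alpha ^ m vanishes as soon as m >= r - rk (join of S), so only  *)
(* alpha ^ d and x_F ^ 2 * alpha ^ (d - 2), with F of rank 2, contribute; the *)
(* linear relations at two points of F turn the latter into - alpha ^ d. Let  *)
(* p_2 = c_1 ^ 2 - 2 c_2, which is additive on K-theory. Then                 *)
(* c_1 ^ 2 alpha ^ (d - 2) = r ^ 2 - N and p_2 alpha ^ (d - 2) = r - 3 N, and *)
(* the claim (d + 1) p_2 <= c_1 ^ 2 is r ^ 2 - 3 r N <= r ^ 2 - N.            *)
Require Import Defs.
From mathcomp Require Import all_boot all_order all_algebra.
From mathcomp Require Import generic_quotient ring_quotient.
From mathcomp Require Import boolp.
From mathcomp Require Import mpoly.
From mathcomp Require Import ring zify.

Set Implicit Arguments.
Unset Strict Implicit.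
Unset Printing Implicit Defensive.

Import Order.TTheory GRing.Theory Num.Theory.

Local Open Scope ring_scope.
Local Open Scope quotient_scope.

(** With n = d - 2, multiplication by [alpha ^+ n] acts like restriction to a surface: a projective
    plane blown up at N points, one for each rank-two flat of [G]. Classes x_F with F of rank at
    least three restrict to zero ([x_alpha_eq0]), those of distinct rank-two flats do not meet
    ([xx_alpha_eq0]), and each rank-two x_F has self-intersection -1 like an exceptional curve
    ([xx_alpha_rank_two]). The rank-one summands of the tangent class cancel, since [theta] vanishes
    there.

    Additivity of the power sums of the Chern roots gives c_1 and p_2 as explicit sums
    ([power_sums_tangent]), which are evaluated in [tangent_sum1_alpha] and [tangent_sum2_alpha].
    The right side of the inequality minus the left side is then (3r - 1)N. *)

Lemma sqrrB_mulrn (R : comPzRingType) (a b y : R) (p : nat) :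
  (a *+ p - y) ^+ 2 * b = a ^+ 2 * b *+ (p ^ 2) - y * (a * b) *+ (p * 2) + y ^+ 2 * b.
Proof.
rewrite [y * _ *+ _]mulrnA -[a *+ p]mulr_natr -[_ *+ (p ^ 2)]mulr_natr natrX -[_ *+ p]mulr_natr.
ring.
Qed.

#[local] Arguments chow_of_divisor {E M G} d : simpl never.

(** * Homogeneous parts in the Chow ring and power sums of Chern roots *)

Section Grading.
Variables (E : finType) (M : matroid E) (G : {set {set E}}).
Local Notation chow := (chow M G).
Local Notation poly := {mpoly int[#|{: ray G}|]}.
Local Notation h := (@homog_part E M G).
Local Notation A := (@chow_homog E M G).

Lemma pihomog_mul (n k : nat) (p q : {mpoly int[n]}) :
  pihomog mdeg k (p * q) =
    \sum_(i < k.+1) pihomog mdeg (k - i) p * pihomog mdeg i q.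
Proof.
(* This bound covers all components of [q] and all indices up to [k], so that both sums embed in one
   range. *)
have le : (mmeasure mdeg q <= maxn k.+1 (mmeasure mdeg q))%N by rewrite leq_maxr.
rewrite {1}(pihomog_partitionE le) mulr_sumr raddf_sum /=.
under eq_bigr do rewrite (pihomogM _ _ (pihomogP mdeg _ q)).
rewrite -big_mkcond /=.
by rewrite (big_ord_widen _ (fun i => pihomog mdeg (k - i) p * pihomog mdeg i q)
  (leq_maxl k.+1 (mmeasure mdeg q))).
Qed.

Lemma homog_partM k (a b : chow) :
  h k (a * b) = \sum_(i < k.+1) h (k - i) a * h i b.
Proof.
rewrite -[a]reprK -[b]reprK -rmorphM homog_part_pi pihomog_mul rmorph_sum /=.
by apply: eq_bigr => i _; rewrite !homog_part_pi rmorphM.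
Qed.

Lemma homog_partD k (a b : chow) : h k (a + b) = h k a + h k b.
Proof. by rewrite -[a]reprK -[b]reprK -rmorphD !homog_part_pi raddfD /= rmorphD. Qed.

Lemma homog_part_homog j k (a : chow) : a \in A k -> h j a = if j == k then a else 0.
Proof.
move=> /asboolP[p hp ->]; rewrite homog_part_pi.
have [->|jk] := eqVneq j k; first by rewrite pihomog_dE.
by rewrite (pihomog_ne0 _ hp) ?raddf0 // eq_sym.
Qed.

Lemma homog_part_in k (a : chow) : h k a \in A k.
Proof. by apply/asboolP; exists (pihomog mdeg k (repr a)); first exact: pihomogP. Qed.

Lemma chow_homogM j k (a b : chow) : a \in A j -> b \in A k -> a * b \in A (j + k).
Proof.
move=> /asboolP[p hp ->] /asboolP[q hq ->]; apply/asboolP.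
by exists (p * q); rewrite ?rmorphM // dhomogM.
Qed.

Lemma chow_homog1 : (1 : chow) \in A 0.
Proof. by apply/asboolP; exists 1; rewrite ?rmorph1 ?dhomog1. Qed.

Lemma chow_homogX (D : divisor M G) n : (D : chow) ^+ n \in A n.
Proof.
elim: n => [|n IH]; first exact: chow_homog1.
by rewrite exprSr -addn1; apply: chow_homogM IH (divisorP D).
Qed.

(* If a is a total Chern class, u is the first and w the second power sum of  *)
(* the Chern roots; unlike the second Chern class, w is additive.             *)
Definition power_sums (a u w : chow) :=
  [/\ h 0 a = 1, h 1 a = u & u ^+ 2 - h 2 a *+ 2 = w].

Lemma power_sums1 : power_sums 1 0 0.
Proof. by rewrite /power_sums !(homog_part_homog _ chow_homog1) /= mul0rn expr0n subr0. Qed.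

Lemma power_sumsM a b u v w z :
  power_sums a u w -> power_sums b v z -> power_sums (a * b) (u + v) (w + z).
Proof.
move=> [a0 a1 <-] [b0 b1 <-]; rewrite /power_sums !homog_partM !big_ord_recl !big_ord0 /=.
rewrite /bump /= !addn0 ?subn0 ?subnn ?subSS ?subn0 ?add1n ?addn1 /= ?subSS ?subn0 ?a0 ?b0 ?a1 ?b1.
by split; ring.
Qed.

Lemma power_sumsX n a u w :
  power_sums a u w -> power_sums (a ^+ n) (u *+ n) (w *+ n).
Proof.
move=> pa; elim: n => [|n IH]; first exact: power_sums1.
by rewrite exprS !mulrS; apply: power_sumsM.
Qed.

Lemma power_sums_prod (I : finType) (a u w : I -> chow) :
  (forall i, power_sums (a i) (u i) (w i)) ->
  power_sums (\prod_i a i) (\sum_i u i) (\sum_i w i).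
Proof.
move=> pa; elim/big_rec3: _ => [|i z y x _ IH]; first exact: power_sums1.
exact: power_sumsM.
Qed.

Lemma power_sumsD1 (D : divisor M G) : power_sums (1 + (D : chow)) D ((D : chow) ^+ 2).
Proof.
rewrite /power_sums !homog_partD !(homog_part_homog _ chow_homog1).
by rewrite !(homog_part_homog _ (divisorP D)) /= !addr0 add0r mul0rn subr0.
Qed.

(** The equation a * a^-1 = 1, solved degree by degree, gives -u in degree 1 and u ^+ 2 - h 2 a in
    degree 2. *)
Lemma power_sumsV a u w : a \is a GRing.unit ->
  power_sums a u w -> power_sums a^-1 (- u) (- w).
Proof.
move=> ua [a0 a1 <-].
have hV k := homog_partM k a a^-1; rewrite divrr // in hV.
have := hV 0%N; have := hV 1%N; have := hV 2%N.
rewrite !(homog_part_homog _ chow_homog1) /= !big_ord_recl !big_ord0 /=.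
rewrite /bump /= !addn0 ?subn0 ?subnn ?subSS ?subn0 ?add1n ?addn1 /= ?subSS ?subn0.
rewrite a0 a1 !addr0 !mul1r => e2 e1 e0; rewrite -e0 mulr1 in e1 e2.
have h1 : h 1 a^-1 = - u by apply/eqP; rewrite -addr_eq0 addrC e1 addrC.
rewrite h1 in e2.
have h2 : h 2 a^-1 = u ^+ 2 - h 2 a.
  transitivity (h 2 a * 1 + (u * - u + h 2 a^-1) - h 2 a + u ^+ 2); first by ring.
  by rewrite -e2; ring.
by split=> //; rewrite h2; ring.
Qed.

End Grading.

(** * Vanishing of monomials times powers of [alpha] *)

Section Vanishing.
Variables (E : finType) (M : matroid E) (G : {set {set E}}).
Hypotheses (E0 : (0 < #|E|)%N) (Mll : loopless M) (Gb : building_set M G)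
  (GE : [set: E] \in G).
Local Notation ray := (ray G).
Local Notation chow := (chow M G).
Local Notation r := (M [set: E]).
Local Notation x F := (x_ F : chow).
Local Notation a := (alpha : chow).

Definition flat_of (F : ray) : {set E} := val F.

Lemma flat_of_inj : injective flat_of.
Proof. exact: val_inj. Qed.

Lemma alpha_sum i : a = \sum_(F : ray | i \in flat_of F) x F.
Proof. by rewrite [in LHS](alphaE M G i) divisor_sum. Qed.

Lemma rk_full_gt0 : (0 < r)%N.
Proof. by case/card_gt0P: E0 => i _; rewrite -(Mll i) rk_mono ?subsetT. Qed.

Lemma rk_gt0 (A : {set E}) i : i \in A -> (0 < M A)%N.
Proof. by move=> iA; rewrite -(Mll i) rk_mono ?sub1set. Qed.

Lemma closure_full (A : {set E}) : M A = r -> cl M A = [set: E].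
Proof.
move=> rA; apply/setP => i; rewrite !inE eqn_leq [X in _ && X]rk_mono ?subsetUr //.
by rewrite rA rk_mono ?subsetT.
Qed.

Lemma rk_setU1_gt (A B : {set E}) i :
  i \notin cl M A -> i \in B -> (M A < M (A :|: B))%N.
Proof.
rewrite inE => iA iB; apply: (@leq_trans (M (i |: A))); last first.
  by apply: rk_mono; rewrite subUset sub1set inE iB orbT subsetUl.
by rewrite ltn_neqAle eq_sym iA rk_mono ?subsetUr.
Qed.

Lemma flat_eq_rk (A B : {set E}) : flat M A -> A \subset B -> (M B <= M A)%N -> A = B.
Proof.
move=> /eqP fA AB le; apply/eqP; rewrite eqEsubset AB /=.
suff : B \subset cl M A by rewrite fA.
apply/subsetP => i iB; apply: contraLR le => iA.
by rewrite -ltnNge -(setUidPr AB); apply: rk_setU1_gt iB.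
Qed.

Lemma ray_flat (F : ray) : flat M (flat_of F).
Proof. by rewrite /flat_of; case: F => F /= /setD1P[_ FG]; case: (proj1 Gb F FG). Qed.

Lemma ray_in (F : ray) : flat_of F \in G.
Proof. by rewrite /flat_of; case: F => F /= /setD1P[]. Qed.

Lemma ray_rk_gt0 (F : ray) : (0 < M (flat_of F))%N.
Proof.
rewrite /flat_of; case: F => F /= /setD1P[_ FG]; have [_ /set0Pn[i]] := proj1 Gb F FG.
exact: rk_gt0.
Qed.

(** The maximal members of [S] form an antichain [C] with the same union. If that union spans, then
    [C] is not empty, a single member would be [E] itself, and two or more would have the join [E],
    which lies in [G]. *)
Lemma nested_rk_lt (S : {set {set E}}) : nested M G S -> (M (cover S) < r)%N.
Proof.
move=> nS; rewrite ltn_neqAle rk_mono ?subsetT // andbT; apply/negP => /eqP rS.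
pose C := [set H | maxset (mem S) H].
have CS H : H \in C -> H \in S by rewrite inE => /maxsetp.
have covC : cover C = cover S.
  apply/eqP; rewrite eqEsubset; apply/andP; split.
    by apply/bigcupsP => H /CS; exact: bigcup_sup.
  apply/bigcupsP => H HS; have [K mK HK] := @maxset_exists _ (mem S) H HS.
  by apply: (subset_trans HK); apply: bigcup_sup; rewrite inE.
have [le1|gt1] := leqP #|C| 1.
  have [C0|[H HC]] := set_0Vmem C.
    by move: rS rk_full_gt0; rewrite -covC C0 /cover big_set0 rk0 => <-.
  have C1 : C = [set H] by apply/eqP; rewrite eq_sym eqEcard sub1set HC cards1.
  have [HG /negP[]] := nestedW nS (CS H HC); apply/eqP.
  move: rS; rewrite -covC C1 /cover big_set1 => /closure_full <-.
  by have [/eqP] := proj1 Gb H HG.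
have := @nested_antichain _ _ _ _ nS C.
rewrite /join covC (closure_full rS) GE => hC; suff: false by []; apply: hC => //.
  by apply/subsetP => H /CS.
apply/forallP => H; apply/implyP => HC; apply/forallP => K.
apply/implyP => KC; apply/implyP => HK.
move: HC; rewrite inE => /maxsetP[_ /(_ K) hK]; apply/eqP/esym; apply: hK => //.
exact: CS.
Qed.

(* The stratum D_S maps to a linear subspace of codimension rk (join of S)    *)
(* under the morphism to projective space defined by alpha.                   *)
Lemma monomial_alpha_eq0 (S : {set ray}) m :
  (r <= m + M (\bigcup_(F in S) flat_of F))%N -> (\prod_(F in S) x F) * a ^+ m = 0.
Proof.
have cov (T : {set ray}) : cover [set flat_of F | F in T] = \bigcup_(F in T) flat_of F.
  exact: cover_imset.
elim: m S => [|m IH] S le.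
  rewrite chow_monomial ?mul0r //; apply/negP => /nested_rk_lt.
  by rewrite cov ltnNge le.
have [lt|ge] := ltnP (M (\bigcup_(F in S) flat_of F)) r; last first.
  rewrite chow_monomial ?mul0r //; apply/negP => /nested_rk_lt.
  by rewrite cov ltnNge ge.
(* Expand one factor [alpha] at a point [j] outside the span: every ray through [j] is new and
   raises the rank, which pays for the lost power of [alpha]. *)
have /existsP[j jS] : [exists j, j \notin cl M (\bigcup_(F in S) flat_of F)].
  rewrite -negb_forall; apply: contraL lt => /forallP clT.
  rewrite -leqNgt -[leqRHS]rk_closure rk_mono //.
  by apply/subsetP => i _.
rewrite exprS mulrA [X in _ * X * _](alpha_sum j) mulr_sumr mulr_suml big1 // => H jH.
have HS : H \notin S.
  apply: contra jS => HS; apply: (subsetP (sub_closure _ _)).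
  by apply/bigcupP; exists H.
rewrite [_ * x H]mulrC -big_setU1 //=; apply: IH.
rewrite bigcup_setU big_set1 setUC.
by apply: leq_trans le _; rewrite addSnnS leq_add2l (rk_setU1_gt jS).
Qed.

Lemma x_alpha_eq0 (F : ray) m : (r <= m + M (flat_of F))%N -> x F * a ^+ m = 0.
Proof. by move=> le; have := @monomial_alpha_eq0 [set F] m; rewrite !big_set1; apply. Qed.

Lemma xx_alpha_eq0 (F H : ray) m : F != H -> (r <= m + M (flat_of F :|: flat_of H))%N ->
  x F * x H * a ^+ m = 0.
Proof.
move=> FH le; have := @monomial_alpha_eq0 [set F; H] m.
by rewrite bigcup_setU !big_set1 big_setU1 ?inE //= big_set1; apply.
Qed.

Lemma non_nested_pair (F H : ray) :
  ~~ (flat_of F \subset flat_of H) -> ~~ (flat_of H \subset flat_of F) ->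
  cl M (flat_of F :|: flat_of H) \in G -> x F * x H = 0.
Proof.
move=> nFH nHF jG; have FH : F != H by apply: contraNneq nFH => ->.
have vFH : flat_of F != flat_of H by rewrite (inj_eq flat_of_inj).
have := @chow_monomial _ M G [set F; H].
rewrite big_setU1 ?inE //= big_set1; apply; rewrite imsetU1 imset_set1.
apply/negP => nS; have := @nested_antichain _ _ _ _ nS [set flat_of F; flat_of H].
rewrite subxx cards2 vFH /join /cover bigcup_setU !big_set1 jG => hC.
suff: false by []; apply: hC => //.
apply/forallP => X; apply/implyP => /set2P[]->; apply/forallP => Y;
  apply/implyP => /set2P[]->; rewrite ?eqxx ?implybT //.
- by rewrite (negPf nFH).
- by rewrite (negPf nHF).
Qed.

(** Without a jump in rank, [H] would lie in the flat [F], and the rank comparison would make them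
    equal. *)
Lemma rk_setU_ray (F H : ray) : F != H -> (M (flat_of F) <= M (flat_of H))%N ->
  (M (flat_of F) < M (flat_of F :|: flat_of H))%N.
Proof.
move=> FH le; rewrite ltnNge; apply: contra FH => le'.
have HF : flat_of H \subset flat_of F.
  by rewrite (flat_eq_rk (ray_flat F) (subsetUl _ _) le') subsetUr.
by apply/eqP/flat_of_inj/esym; exact: flat_eq_rk (ray_flat H) HF le.
Qed.

(** * Intersection numbers of rank-two flats, with n = d - 2 *)

Section RankTwo.
Variable n : nat.
Hypothesis rE : r = n.+3.

(** Expand one [alpha] at [i]: against [alpha ^+ n.+1] only rank one survives, so the sum has [cl M
    [set i]] as its only possible flat. Expand a second [alpha] at a point [j] of [F] outside that
    flat: only x_F survives. *)
Lemma alpha_top_two (F : ray) i : M (flat_of F) = 2%N -> i \in flat_of F ->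
  a ^+ n.+2 = x F * a ^+ n * \sum_(H : ray | (i \in flat_of H) && (M (flat_of H) == 1%N)) x H.
Proof.
move=> F2 iF; set Y := \sum_(H | _) _.
have rk1_closure (H : ray) k : k \in flat_of H -> M (flat_of H) == 1%N -> flat_of H = cl M [set k].
  move=> kH /eqP H1; apply/esym/flat_eq_rk; first exact: flat_closure.
    by apply: closure_sub_flat; rewrite ?ray_flat ?sub1set.
  by rewrite rk_closure Mll H1.
have splitY : a ^+ n.+2 = a ^+ n.+1 * Y.
  rewrite exprSr [X in _ * X](alpha_sum i) (bigID (fun H : ray => M (flat_of H) == 1%N)) /=.
  rewrite mulrDr [X in _ + X = _]mulr_sumr [X in _ + X = _]big1 ?addr0 // => H /andP[_ H1].
  by rewrite mulrC x_alpha_eq0 // rE; have := ray_rk_gt0 H; lia.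
have /subsetPn[j jF ji] : ~~ (flat_of F \subset cl M [set i]).
  by apply/negP => /(rk_mono M); rewrite rk_closure Mll F2.
have iFj : flat_of F = cl M [set i; j].
  apply/esym/flat_eq_rk; first exact: flat_closure.
    by apply: closure_sub_flat; rewrite ?ray_flat // subUset !sub1set iF.
  by rewrite rk_closure F2; have := rk_setU1_gt ji (set11 j); rewrite Mll.
suff YK (K : ray) : j \in flat_of K -> K != F -> Y * x K * a ^+ n = 0.
  rewrite splitY exprS; transitivity (Y * a * a ^+ n); first by ring.
  rewrite [X in Y * X](alpha_sum j) mulr_sumr mulr_suml.
  by rewrite (bigD1 F) //= big1 => [|K /andP[]]; [ring | exact: YK].
move=> jK KF; rewrite /Y !mulr_suml big1 // => H /andP[iH H1].
have Hi := rk1_closure H i iH H1; rewrite -Hi in ji.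
have HK : H != K by apply: contraNneq ji => ->.
(* Either the union has rank at least three and the product dies against [alpha ^+ n], or [H] and
   [K] span [F]; they are then incomparable with join in [G], hence not nested. *)
have [ge|lt] := leqP 3 (M (flat_of H :|: flat_of K)); first by rewrite xx_alpha_eq0 // rE; lia.
have FHK : flat_of F = cl M (flat_of H :|: flat_of K).
  apply: flat_eq_rk (ray_flat F) _ _; last by rewrite rk_closure F2; lia.
  rewrite iFj; apply: closure_mono; rewrite subUset !sub1set !inE iH jK.
  by rewrite orbT.
rewrite non_nested_pair ?mul0r // -?FHK ?ray_in //.
- apply: contra HK => HsK; apply/eqP/flat_of_inj; apply: flat_eq_rk (ray_flat H) HsK _.
  rewrite (eqP H1) leqNgt; apply: contra KF => K2; apply/eqP/flat_of_inj.
  apply: flat_eq_rk (ray_flat K) _ _; last by rewrite F2.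
  by rewrite FHK; apply: subset_trans (sub_closure _ _); rewrite subsetUr.
- by apply: contra ji => /subsetP; apply.
Qed.

(** Expand one [alpha] of x_F * alpha ^ (n + 1) = 0 at a point of [F]. What survives is x_F itself
    and the rank-one ray; the latter contributes [a ^+ n.+2] by [alpha_top_two]. *)
Lemma xx_alpha_rank_two (F : ray) : M (flat_of F) = 2%N ->
  x F ^+ 2 * a ^+ n = - a ^+ n.+2.
Proof.
move=> F2; have [i iF] : exists i, i \in flat_of F.
  by apply/set0Pn; case: (proj1 Gb _ (ray_in F)).
have : x F * a ^+ n.+1 = 0 by rewrite x_alpha_eq0 // rE F2; lia.
rewrite exprS mulrA [X in x F * X](alpha_sum i) mulr_sumr mulr_suml.
rewrite (bigD1 F) //= (bigID (fun H : ray => M (flat_of H) == 1%N)) /=.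
rewrite [X in _ + (_ + X)]big1 => [|H /andP[/andP[iH HF] H1]]; last first.
  have FH : F != H by rewrite eq_sym.
  have H2 : (M (flat_of F) <= M (flat_of H))%N by rewrite F2; have := ray_rk_gt0 H; lia.
  by rewrite xx_alpha_eq0 // rE; have := rk_setU_ray FH H2; lia.
rewrite addr0 expr2 => /eqP; rewrite addr_eq0 => /eqP ->; congr (- _).
rewrite (alpha_top_two F2 iF) mulr_sumr; apply: eq_big => [H|H _]; last by ring.
have [->|] := eqVneq H F; first by rewrite F2 !andbF.
by rewrite andbT.
Qed.

(** * The [theta] classes and the power sums of the tangent class *)

Local Notation k F := (M (flat_of F)).
Local Notation th F := (theta F : chow).

Lemma thetaE (F : ray) :
  th F = a - \sum_(H : ray | flat_of F \subset flat_of H) x H.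
Proof. by rewrite -divisor_sum. Qed.

(** A flat through a point of a rank-one flat [F] contains [F], so both sums in [theta F] run over
    the same rays. *)
Lemma theta_rank_one (F : ray) : k F = 1%N -> th F = 0.
Proof.
move=> F1; have [i iF] : exists i, i \in flat_of F.
  by apply/set0Pn; case: (proj1 Gb _ (ray_in F)).
rewrite thetaE (alpha_sum i); apply/eqP; rewrite subr_eq0; apply/eqP.
apply: eq_bigl => H; apply/idP/idP => [iH|/subsetP]; last exact.
suff -> : flat_of F = cl M [set i] by apply: closure_sub_flat; rewrite ?ray_flat ?sub1set.
apply/esym/flat_eq_rk; first exact: flat_closure.
  by apply: closure_sub_flat; rewrite ?ray_flat ?sub1set.
by rewrite rk_closure Mll F1.
Qed.

Lemma xtheta_rank_two (F : ray) : k F = 2%N -> th F * x F * a ^+ n = a ^+ n.+2.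
Proof.
move=> F2; rewrite thetaE !mulrBl.
have -> : a * x F * a ^+ n = 0.
  by rewrite mulrAC -exprS mulrC x_alpha_eq0 // rE F2; lia.
rewrite !mulr_suml (bigD1 F) //= big1 => [|H /andP[FH HF]]; last first.
  rewrite xx_alpha_eq0 // rE setUC.
  have FH' : F != H by rewrite eq_sym.
  by have := rk_setU_ray FH' (rk_mono M FH); lia.
by rewrite addr0 sub0r -expr2 xx_alpha_rank_two // opprK.
Qed.

Definition rank_two : nat := #|[set F : ray | k F == 2%N]|.

(** Power sums read off the tangent class: each O(D) contributes D here and D^2 in
    [tangent_sum2]. *)
Definition tangent_sum1 : chow :=
  a *+ r + \sum_(F : ray) (x F + (th F - (th F + x F)) *+ k F).

Definition tangent_sum2 : chow :=
  a ^+ 2 *+ r + \sum_(F : ray) (x F ^+ 2 + (th F ^+ 2 - (th F + x F) ^+ 2) *+ k F).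

(** After cancelling [theta], x_F carries the coefficient -(rk F - 1). This removes rank one, and in
    the square only the diagonal terms of rank two survive, each with weight 1. *)
Lemma tangent_sum1_alpha :
  tangent_sum1 ^+ 2 * a ^+ n = a ^+ n.+2 *+ (r ^ 2) - a ^+ n.+2 *+ rank_two.
Proof.
pose Y := \sum_(F : ray) x F *+ (k F).-1.
have -> : tangent_sum1 = a *+ r - Y.
  rewrite /tangent_sum1 -sumrN; congr (_ + _); apply: eq_bigr => F _.
  by have := ray_rk_gt0 F; case: (k F) => // m _; rewrite mulrS /=; ring.
have Y1 : Y * a ^+ n.+1 = 0.
  rewrite mulr_suml big1 // => F _; rewrite mulrnAl.
  have [le|gt] := leqP (k F) 1; first by have := ray_rk_gt0 F; case: (k F) le => [|[]].
  by rewrite x_alpha_eq0 ?mul0rn // rE; lia.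
have term (F H : ray) : (x F *+ (k F).-1) * (x H *+ (k H).-1) * a ^+ n =
    if (H == F) && (k F == 2%N) then - a ^+ n.+2 else 0.
  transitivity ((x F * x H * a ^+ n) *+ ((k F).-1 * (k H).-1)).
    by rewrite mulrnAl mulrnAr -mulrnA mulrnAl mulnC.
  have [F1|F2] := leqP (k F) 1.
    rewrite (_ : k F = 1%N) ?andbF ?mul0n //.
    by apply/eqP; rewrite eqn_leq F1 ray_rk_gt0.
  have [->|HF] := eqVneq H F.
    have [F2'|nF2] := eqVneq (k F) 2%N.
      by rewrite F2' -expr2 xx_alpha_rank_two.
    by rewrite -mulrA x_alpha_eq0 ?mulr0 ?mul0rn // rE; lia.
  have [H1|H2] := leqP (k H) 1.
    rewrite (_ : k H = 1%N) ?muln0 //.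
    by apply/eqP; rewrite eqn_leq H1 ray_rk_gt0.
  have FH : F != H by rewrite eq_sym.
  rewrite xx_alpha_eq0 ?mul0rn // rE.
  have [le|/ltnW le] := leqP (k F) (k H).
    by have := rk_setU_ray FH le; lia.
  by have := rk_setU_ray HF le; rewrite setUC; lia.
have Y2 : Y ^+ 2 * a ^+ n = - a ^+ n.+2 *+ rank_two.
  rewrite expr2 mulr_suml mulr_suml -sumr_const [RHS]big_mkcond /=.
  apply: eq_bigr => F _; rewrite inE mulr_sumr mulr_suml (bigD1 F) //= big1.
    by rewrite term eqxx addr0.
  by move=> H /negPf HF; rewrite term HF.
by rewrite sqrrB_mulrn -exprS Y1 mul0rn subr0 Y2 -exprD add2n mulNrn.
Qed.

(** The summand of [F] is x_F (x_F - k (2 theta_F + x_F)) with k = rk F. It is 0 for k = 1, as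
    theta_F = 0; for k = 2 it is -x_F^2 - 4 theta_F x_F, of value 1 - 4 = -3; for larger k, x_F dies
    against [alpha ^+ n]. *)
Lemma tangent_sum2_alpha :
  tangent_sum2 * a ^+ n = a ^+ n.+2 *+ r - a ^+ n.+2 *+ (3 * rank_two).
Proof.
rewrite mulrDl mulrnAl -exprD add2n; congr (_ + _).
rewrite mulrnA -mulNrn -sumr_const big_distrl /= [RHS]big_mkcond /=.
apply: eq_bigr => F _; rewrite inE.
have [F1|nF1] := eqVneq (k F) 1%N.
  by rewrite F1 theta_rank_one //=; ring.
have [F2|nF2] := eqVneq (k F) 2%N.
  transitivity (- (x F ^+ 2 * a ^+ n) - (th F * x F * a ^+ n) *+ 4).
    by rewrite F2; ring.
  by rewrite xx_alpha_rank_two // xtheta_rank_two //; ring.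
transitivity ((x F - (th F *+ 2 + x F) *+ k F) * (x F * a ^+ n)); first by ring.
by rewrite x_alpha_eq0 ?mulr0 // rE; have := ray_rk_gt0 F; lia.
Qed.

Lemma power_sums_tangent : power_sums (chern (tangent_class M G)) tangent_sum1 tangent_sum2.
Proof.
rewrite chern_tangent //; apply: power_sumsM.
  exact/power_sumsX/power_sumsD1.
apply: power_sums_prod => F; apply: power_sumsM; first exact: power_sumsD1.
apply/power_sumsX/power_sumsM; first exact: power_sumsD1.
rewrite -addrA; apply: power_sumsV; first exact: (divisor_unit Mll Gb GE (theta F + x_ F)).
exact: (power_sumsD1 (theta F + x_ F)).
Qed.

End RankTwo.

End Vanishing.

(** * Degrees and the final inequality *)

Lemma degree_intmul (E : finType) (M : matroid E) (G : {set {set E}})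
    (deg : chow M G -> int) (z : chow M G) (m : int) :
  degree_iso deg -> z \in chow_homog (M [set: E]).-1 -> deg (z *~ m) = deg z *~ m.
Proof.
move=> [degD _ _ _] zA.
(* [deg] is a bare function, additive only on the top degree part, so zero, multiples and opposites
   are handled there by hand. *)
have deg0 : deg 0 = 0.
  by apply: (addrI (deg 0)); rewrite -degD ?rpred0 // !addr0.
have degMn p : deg (z *+ p) = deg z *+ p.
  by elim: p => [|p IH] //; rewrite !mulrS degD ?rpredMn ?IH.
case: m => p; first exact: degMn.
rewrite NegzE !mulrNz -[z *~ _]/(z *+ p.+1) -[deg z *~ _]/(deg z *+ p.+1) -degMn.
apply: (addrI (deg (z *+ p.+1))).
by rewrite -degD ?rpredN ?rpredMn // !subrr deg0.
Qed.

Theorem corollary4p23 (E : finType) (M : matroid E) (G : {set {set E}})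
    (deg : chow M G -> int) :
  (0 < #|E|)%N -> loopless M -> building_set M G -> [set: E] \in G ->
  degree_iso deg ->
  let d := (M [set: E]).-1 in
  (2 <= d)%N ->
  let T := tangent_class M G in
  let a : chow M G := alpha in
  d%:R * deg (chern_class 1 T ^+ 2 * a ^+ (d - 2))
    <= 2 * (d + 1)%:R * deg (chern_class 2 T * a ^+ (d - 2)).
Proof.
move=> E0 Mll Gb GE degI d d2; cbv zeta.
set T := tangent_class M G; set a := chow_of_divisor alpha.
have [n rE] : exists n, M [set: E] = n.+3.
  by exists (d - 2)%N; rewrite /d in d2 *; lia.
have dE : d = n.+2 by rewrite /d rE.
have [_ c1 c2] := power_sums_tangent Mll Gb GE.
have deg_top m : deg (a ^+ n.+2 *~ m) = m.
  have aA : a ^+ n.+2 \in chow_homog d by rewrite dE chow_homogX.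
  rewrite (degree_intmul m degI aA); case: degI => _ _ _.
  by rewrite -[X in _ ^+ X]/d dE => ->; rewrite intz.
have sqrE : n.+3%:Z ^+ 2 = (n.+3 ^ 2)%N by lia.
rewrite dE subn2 /= /chern_class c1.
set N := rank_two M G; set c := homog_part 2 _ in c2 *.
have -> : deg (tangent_sum1 M G ^+ 2 * a ^+ n) = n.+3%:Z ^+ 2 - N%:Z.
  rewrite (tangent_sum1_alpha E0 Mll Gb GE rE) rE -/N -[RHS]deg_top.
  by rewrite sqrE mulrzBr.
have cA : c * a ^+ n \in chow_homog d.
  by rewrite dE -add2n; apply: chow_homogM; rewrite ?homog_part_in ?chow_homogX.
(* Twice c_2 is c_1^2 - p_2; doubling avoids division in the integers. *)
have : deg (c * a ^+ n) *~ 2 = n.+3%:Z ^+ 2 - N%:Z - (n.+3%:Z - 3 * N%:Z).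
  rewrite -(degree_intmul 2 degI cA) -[RHS]deg_top; congr deg.
  transitivity ((tangent_sum1 M G ^+ 2 - tangent_sum2 M G) * a ^+ n).
    by rewrite -c2 -[LHS]/(_ *+ 2); ring.
  rewrite mulrBl (tangent_sum1_alpha E0 Mll Gb GE rE) (tangent_sum2_alpha E0 Mll Gb GE rE) rE -/N.
  by rewrite sqrE -PoszM !mulrzBr.
(* With r = n + 3, the gap between the two sides is (r^2 - N) - r (r - 3N) = (3r - 1)N. *)
move: (deg _) => D; rewrite -mulrzr => hD; nia.
Qed.
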